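(* Let $n\ge 2$ and let $q$ be a prime power. Let $c$ be chosen uniformly at random among the $q^{n-1}$ semisimple conjugacy classes of $SL(n,q)$. Then the probability that $\Phi(c)$ is the conjugacy class of the identity of $S_n$ is equal to the coefficient of the identity element in $x_q$.
   Context: A semisimple conjugacy class $c$ of $SL(n,q)$ is determined by the characteristic polynomial of its elements, and the polynomials that occur are exactly the monic degree $n$ polynomials over $F_q$ whose roots (with multiplicity) have product $1$. Such a polynomial factors as $\prod_i f_i^{a_i}$ with $f_i$ distinct monic irreducible over $F_q$ of degree $d_i$; $\Phi(c)$ is the conjugacy class of $S_n$ of permutations whose cycle type is the partition in which $d_i$ is repeated $a_i$ times for each $i$. For a positive integer $k$, the element $x_k$ (Cellini's element in type $A_{n-1}$) of the rational group algebra of $S_n$ is defined by: the coefficient of $w$ in $x_k$ is $\frac{1}{k^{n-1}}$ times the number of integer vectors $(v_1,\dots,v_n)$ such that (i) $v_1+\dots+v_n=0$; (ii) $v_1\ge v_2\ge\dots\ge v_n$ and $v_1-v_n\le k$; (iii) $v_i>v_{i+1}$ whenever $1\le i\le n-1$ and $w(i)>w(i+1)$; (iv) $v_1<v_n+k$ if $w(n)>w(1)$. *)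

(* Defs.v *)
(* MathComp, with classical sets and Booleans from mathcomp.classical. *)
From HB Require Import structures.
From mathcomp Require Import all_boot all_order all_fingroup all_algebra all_field.
From mathcomp Require Import mathcomp_extra boolp classical_sets cardinality.
From mathcomp Require Import finmap.

Set Implicit Arguments.
Unset Strict Implicit.
Unset Printing Implicit Defensive.

Import Order.TTheory GRing.Theory Num.Theory.

Local Open Scope ring_scope.

Section SemisimpleClasses.
Variables (F : finFieldType) (n : nat).

(* {'GL_n[F]} consists of matrices of size n.-1.+1, which is n when n > 0. *)
Definition SL_set : {set {'GL_n[F]}} := [set u | \det (GLval u) == 1]%SET.

Lemma SL_group_set : group_set SL_set.
Proof.
apply/group_setP; split=> [|u v]; first by rewrite inE det1.
by rewrite !inE GL_MxE det_mulmx => /eqP-> /eqP->; rewrite mulr1.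
Qed.
Canonical SL_group := Group SL_group_set.

(* Over a finite field, being diagonalizable over an algebraic closure is     *)
(* being diagonalizable over some finite extension: the entries of a          *)
(* diagonalizing matrix are algebraic, and they are finitely many.            *)
Definition semisimple m (A : 'M[F]_m) : Prop :=
  exists L : fieldExtType F, diagonalizable (map_mx (in_alg L) A).

Definition ss_classes : {set {set {'GL_n[F]}}} :=
  [set (u ^: SL_set)%g | u in SL_set & `[< semisimple (GLval u) >]]%SET.

Definition cycle_type (w : 'S_n) : seq nat :=
  [seq #|C| | C : {set 'I_n} <- enum (porbits w)].

(* ds is, up to order, the list of the degrees of the monic irreducible       *)
(* factors of p, each counted as often as it occurs in the factorization.     *)
Definition factor_degrees (p : {poly F}) (ds : seq nat) : Prop :=
  exists fs : seq {poly F},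
    [/\ forall f, f \in fs -> f \is monic /\ irreducible_poly f,
        p = \prod_(f <- fs) f
      & perm_eq [seq (size (f : {poly F})).-1 | f <- fs] ds].

(* All elements of a class have the same characteristic polynomial, so that   *)
(* any of them may serve to define Phi.                                       *)
Definition Phi (c : {set {'GL_n[F]}}) : {set 'S_n} :=
  [set w | `[< exists2 u, u \in c
               & factor_degrees (char_poly (GLval u)) (cycle_type w) >]]%SET.

End SemisimpleClasses.

Section Cellini.
Variable n : nat.

(* Coordinates and points are numbered from 0, so that the first one is 0 and *)
(* the last one is n.-1.                                                      *)
Definition cellini_vectors (k : nat) (w : 'S_n) : set {ffun 'I_n -> int} :=
  [set v : {ffun 'I_n -> int} |
    [/\ \sum_i v i = 0,
        (forall i j : 'I_n, j = i.+1 :> nat -> v j <= v i) /\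
        (forall i j : 'I_n, i = 0%N :> nat -> j = n.-1 :> nat ->
           v i - v j <= k%:Z),
        forall i j : 'I_n, j = i.+1 :> nat -> (w j < w i)%N -> v j < v i
      & forall i j : 'I_n, i = 0%N :> nat -> j = n.-1 :> nat ->
          (w i < w j)%N -> v i < v j + k%:Z]]%classic.

(* An element of the rational group algebra of 'S_n is given by its           *)
(* coefficients. The cardinal below is that of a finite set, by               *)
(* cellini_vectors_finite.                                                    *)
Definition cellini (k : nat) : {ffun 'S_n -> rat} :=
  [ffun w => #|` fset_set (cellini_vectors k w)|%:R / k%:R ^+ n.-1].

Lemma cellini_vectors_finite k w : finite_set (cellini_vectors k w).
Proof.
pose g (f : {ffun 'I_n -> 'I_(k + k).+1}) : {ffun 'I_n -> int} :=
  [ffun i => (f i : nat)%:Z - k%:Z].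
apply: (@sub_finite_set _ _ (g @` setT)%classic); last first.
  exact/finite_image/finite_finset.
move=> v [sum0 [dec wid] _ _].
have mono (i j : 'I_n) : (i <= j)%N -> v j <= v i.
  case: j => j ltj; elim: j ltj => [|j IHj] ltj /= le_ij.
    by rewrite (_ : Ordinal ltj = i) //; apply: val_inj => /=; case: (i : nat) le_ij.
  have [eq_ij|ne_ij] := eqVneq (i : nat) j.+1.
    by rewrite (_ : Ordinal ltj = i) //; apply: val_inj.
  have ltj' := ltnW ltj.
  have le_ij' : (i <= j)%N by rewrite -ltnS ltn_neqAle ne_ij.
  exact: le_trans (dec (Ordinal ltj') (Ordinal ltj) erefl) (IHj ltj' le_ij').
have bnd (i : 'I_n) : - k%:Z <= v i <= k%:Z.
  have n0 : (0 < n)%N by apply: leq_ltn_trans (ltn_ord i).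
  have nlt : (n.-1 < n)%N by rewrite prednK.
  pose a := Ordinal n0; pose z := Ordinal nlt.
  have va j : v j <= v a by apply: mono.
  have vz j : v z <= v j by apply: mono; rewrite /= -ltnS prednK.
  have wd : v a - v z <= k%:Z by apply: wid.
  have a0 : 0 <= v a.
    rewrite leNgt; apply/negP => a_lt0.
    have : \sum_j v j < 0; last by rewrite sum0 ltxx.
    rewrite (bigD1 a) //= -[ltRHS]addr0 ltr_leD // sumr_le0 // => j _.
    exact: le_trans (va j) (ltW a_lt0).
  have z0 : v z <= 0.
    rewrite leNgt; apply/negP => z_gt0.
    have : 0 < \sum_j v j; last by rewrite sum0 ltxx.
    rewrite (bigD1 z) //= -[ltLHS]addr0 ltr_leD // sumr_ge0 // => j _.
    exact: le_trans (ltW z_gt0) (vz j).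
  have ak : v a <= k%:Z by apply: le_trans wd; rewrite lerBrDr gerDl.
  have zk : - k%:Z <= v z.
    by rewrite lerNl; apply: le_trans wd; rewrite -lerBlDr opprK addNr.
  by rewrite (le_trans zk (vz i)) (le_trans (va i) ak).
have lt_k i : (absz (v i + k%:Z)%R < (k + k).+1)%N.
  have /andP[lo hi] := bnd i.
  rewrite ltnS -lez_nat gez0_abs; last by rewrite -lerBlDr sub0r.
  by rewrite PoszD lerD2r.
exists [ffun i => Ordinal (lt_k i)] => //; apply/ffunP => i; rewrite !ffunE /=.
have /andP[lo _] := bnd i.
by rewrite gez0_abs ?addrK // -lerBlDr sub0r.
Qed.

End Cellini.

(* Main.v *)
Require Import Defs.
From HB Require Import structures.
From mathcomp Require Import all_boot all_order all_fingroup all_solvable.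
From mathcomp Require Import all_algebra all_field.
From mathcomp Require Import boolp classical_sets cardinality finmap zify.

Set Implicit Arguments.
Unset Strict Implicit.
Unset Printing Implicit Defensive.

Import Order.TTheory GRing.Theory Num.Theory.

Local Open Scope ring_scope.

(** Why the two numbers agree.

    Semisimple classes of the special linear group are parametrized by their
    characteristic polynomials, which are the monic polynomials of degree n
    with constant term (-1)^n; only the n - 1 middle coefficients are free, so
    there are q^(n-1) classes. Surjectivity ([class_char_poly_surj]) comes
    from factoring the polynomial into irreducibles and taking the direct sum
    of the companion matrices of the factors. This sum is semisimple because
    an irreducible polynomial over a finite field is separable.

    Injectivity ([class_char_poly_inj]) has two ingredients. A semisimple
    matrix is annihilated by a separable polynomial, so the cyclic subspaces
    generated by vectors killed by irreducible polynomials exhaust the space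
    in a direct sum, and the matrix is similar to the direct sum of the
    companion matrices of the irreducible factors of its characteristic
    polynomial ([separable_annihilator_companion]). This gives conjugacy in
    GL. To pass from GL to SL one corrects the determinant of the conjugating
    matrix by an element of the centralizer: on the first companion block the
    centralizer is an extension of the field, on its nonzero elements the
    determinant is the norm, and the norm of finite fields is surjective
    ([centralizer_det_surjective]).

    The class c is sent to the identity of the symmetric group exactly when
    its characteristic polynomial is a product of linear factors
    ([Phi_identity]). Let g generate the multiplicative group and m = q - 1.
    Taking logarithms, such polynomials are the multisets of n residues mod m
    whose sum is 0 mod m. For w the identity the Cellini vectors are the
    decreasing integer vectors v of sum 0 with v_1 - v_n <= m, and v
    corresponds to the product of the X - g^(v_i). To see that this is a
    bijection, lift a multiset of n residues to all the integers having these
    residues, and list them as a decreasing sequence u with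
    u_(i+n) = u_i - m. A decreasing vector with v_1 - v_n <= m is a block of n
    consecutive terms of such a sequence; shifting the block by one place
    lowers its sum by m, so exactly one block has sum 0 as soon as the sum is
    a multiple of m ([window_mod_inj], [window_mod_surj]). *)

(** * Factorization of polynomials over a field *)

Definition monic_irreducible (F : fieldType) (f : {poly F}) : Prop :=
  f \is monic /\ irreducible_poly f.

Lemma irreducible_factor_exists (F : fieldType) (p : {poly F}) :
  (1 < size p)%N -> exists2 f, monic_irreducible f & f %| p.
Proof.
have [m] := ubnP (size p); elim: m p => // m IHm p /ltnSE le_m p_gt1.
have [irr_p|red_p] := pselect (irreducible_poly p).
  have p0 := irredp_neq0 irr_p.
  have lc0 : (lead_coef p)^-1 != 0 by rewrite invr_eq0 lead_coef_eq0.
  exists ((lead_coef p)^-1 *: p); last by rewrite dvdpZl.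
  split; first by rewrite monicE lead_coefZ mulVf // lead_coef_eq0.
  split=> [|d d1 dp]; first by rewrite size_scale.
  rewrite dvdpZr // in dp.
  by rewrite (eqp_trans (irr_p d d1 dp)) // eqp_sym eqp_scale.
have [d [d1 dp dnp]] :
    exists d : {poly F}, [/\ size d != 1%N, d %| p & ~~ (d %= p)].
  apply: contrapT => no_d; apply: red_p; split=> // d d1 dp.
  by apply: contrapT => dnp; apply: no_d; exists d; split=> //; apply/negP.
have p0 : p != 0 by rewrite -size_poly_gt0 ltnW.
have d_lt : (size d < size p)%N by rewrite ltn_neqAle dvdp_size_eqp // dnp dvdp_leq.
have d_gt1 : (1 < size d)%N.
  by rewrite ltn_neqAle eq_sym d1 size_poly_gt0 (dvdpN0 dp).
have [f irr_f fd] := IHm d (leq_trans d_lt le_m) d_gt1.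
by exists f => //; apply: dvdp_trans fd dp.
Qed.

Lemma monic_factorization (F : fieldType) (p : {poly F}) :
  p \is monic ->
  exists2 fs : seq {poly F}, forall f, f \in fs -> monic_irreducible f
    & p = \prod_(f <- fs) f.
Proof.
have [m] := ubnP (size p); elim: m p => // m IHm p /ltnSE le_m mon_p.
have [p_le1|p_gt1] := leqP (size p) 1.
  exists [::] => //; rewrite big_nil.
  have := mon_p; rewrite (size1_polyC p_le1) monicE lead_coefC => /eqP->.
  by rewrite -polyC1.
have [f irr_f /dvdpP[g def_p]] := irreducible_factor_exists p_gt1.
have [mon_f [f_gt1 _]] := irr_f.
have mon_g : g \is monic by rewrite -(monicMr g mon_f) -def_p.
have g_lt : (size g < m)%N.
  apply: leq_trans le_m; rewrite def_p size_Mmonic ?monic_neq0 //.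
  by rewrite -subn1 -addnBA ?(ltnW f_gt1) // -[ltnLHS]addn0 ltn_add2l subn_gt0.
have [fs irr_fs def_g] := IHm g g_lt mon_g.
exists (f :: fs) => [h|]; last by rewrite big_cons -def_g mulrC.
by rewrite inE => /orP[/eqP->|/irr_fs].
Qed.

Lemma irreducible_coprime (F : fieldType) (f g : {poly F}) :
  irreducible_poly f -> coprimep f g = ~~ (f %| g).
Proof.
move=> irr_f; have [f_gt1 _] := irr_f; apply/idP/idP=> [co|ndv].
  apply/negP => fg; have := coprimep_dvdl fg co.
  by rewrite coprimepp => /eqP f1; rewrite f1 in f_gt1.
rewrite /coprimep; apply: contraR ndv => g1.
have := irr_f _ g1 (dvdp_gcdl f g) => /andP[_ dv].
exact: dvdp_trans dv (dvdp_gcdr f g).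
Qed.

(** Euclid's lemma; it is what makes factorizations unique. *)
Lemma irreducible_dvd_prod (F : fieldType) (f : {poly F}) (gs : seq {poly F}) :
  irreducible_poly f -> f %| \prod_(g <- gs) g -> exists2 g, g \in gs & f %| g.
Proof.
move=> irr_f; elim: gs => [|g gs IHgs].
  rewrite big_nil dvdp1 => /eqP f1.
  by have [] := irr_f; rewrite f1.
rewrite big_cons; have [fg _|nfg] := boolP (f %| g);
  first by exists g; rewrite ?mem_head.
rewrite Gauss_dvdpr ?irreducible_coprime // => /IHgs[h h_gs fh].
by exists h; rewrite // inE h_gs orbT.
Qed.

Lemma monic_irreducible_dvd_eq (F : fieldType) (f g : {poly F}) :
  monic_irreducible f -> monic_irreducible g -> f %| g -> f = g.
Proof.
move=> [mon_f [f_gt1 _]] [mon_g irr_g] fg; apply/eqP; rewrite -eqp_monic //.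
by apply: irr_g => //; rewrite gtn_eqF.
Qed.

(** The multiset of irreducible factors is read off the product, so that two
    matrices with the same characteristic polynomial get the same list of
    companion blocks up to order. *)
Lemma factorization_unique (F : fieldType) (fs gs : seq {poly F}) :
    (forall f, f \in fs -> monic_irreducible f) ->
    (forall g, g \in gs -> monic_irreducible g) ->
  \prod_(f <- fs) f = \prod_(g <- gs) g -> perm_eq fs gs.
Proof.
elim: fs gs => [|f fs IHfs] gs irr_fs irr_gs eq_fg.
  case: gs => [|g gs] // in irr_gs eq_fg *.
  have [_ [g_gt1 _]] := irr_gs g (mem_head _ _).
  have : g %| 1 by rewrite -[1](@big_nil _ _ *%R _ predT id) eq_fg big_cons dvdp_mulr.
  by rewrite dvdp1 => /eqP g1; rewrite g1 in g_gt1.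
have irr_f := irr_fs f (mem_head _ _).
have [g g_gs fg] : exists2 g, g \in gs & f %| g.
  by apply: irreducible_dvd_prod; [case: irr_f | rewrite -eq_fg big_cons dvdp_mulr].
have def_f := monic_irreducible_dvd_eq irr_f (irr_gs g g_gs) fg.
rewrite -def_f in g_gs; rewrite perm_sym (permPl (perm_to_rem g_gs)) perm_cons.
rewrite perm_sym; apply: IHfs => [h h_fs|h /mem_rem|];
  first by apply: irr_fs; rewrite inE h_fs orbT.
  exact: irr_gs.
have f0 : f != 0 by rewrite monic_neq0 //; case: irr_f.
by apply: (mulfI f0); move: eq_fg; rewrite big_cons (big_rem f g_gs).
Qed.

(** * Similarity and direct sums of companion matrices *)

(** The two sizes are allowed to differ syntactically: the size of a sum of
    companion blocks is a sum of degrees, which is only provably equal to the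
    size of the matrix under study, and no cast is then needed. *)
Definition mx_similar (F : fieldType) m n (A : 'M[F]_m) (B : 'M[F]_n) : Prop :=
  exists P : 'M[F]_(n, m), exists Q : 'M[F]_(m, n),
    [/\ P *m Q = 1%:M, Q *m P = 1%:M & P *m A = B *m P].

(** Recursion on the list, rather than a big operator, makes the size of the
    block matrix below compute. *)
Fixpoint total_degree (F : fieldType) (fs : seq {poly F}) : nat :=
  if fs is f :: fs' then (size f).-1 + total_degree fs' else 0.

Fixpoint companion_sum (F : fieldType) (fs : seq {poly F}) :
    'M[F]_(total_degree fs) :=
  if fs is f :: fs' then block_mx (companionmx f) 0 0 (companion_sum fs') else 0.

Section Similarity.
Variable F : fieldType.

Lemma mx_similar_sym m n (A : 'M[F]_m) (B : 'M[F]_n) :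
  mx_similar A B -> mx_similar B A.
Proof.
move=> [P [Q [PQ QP PA]]]; exists Q, P; split=> //.
rewrite -[RHS]mulmx1 -PQ mulmxA -[A *m Q]mul1mx -QP !mulmxA.
by rewrite -[Q *m P *m A]mulmxA PA !mulmxA
  -[_ *m P *m Q]mulmxA PQ mulmx1 -[_ *m P *m Q]mulmxA PQ mulmx1.
Qed.

Lemma mx_similar_trans m n p (A : 'M[F]_m) (B : 'M[F]_n) (C : 'M[F]_p) :
  mx_similar A B -> mx_similar B C -> mx_similar A C.
Proof.
move=> [P [Q [PQ QP PA]]] [P' [Q' [PQ' QP' PB]]].
exists (P' *m P), (Q *m Q'); split.
- by rewrite mulmxA -(mulmxA P') PQ mulmx1.
- by rewrite mulmxA -(mulmxA Q) QP' mulmx1.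
- by rewrite -mulmxA PA mulmxA PB mulmxA.
Qed.

Lemma mx_similar_block m n n' (C : 'M[F]_m) (A : 'M[F]_n) (B : 'M[F]_n') :
  mx_similar A B -> mx_similar (block_mx C 0 0 A) (block_mx C 0 0 B).
Proof.
move=> [P [Q [PQ QP PA]]].
exists (block_mx 1%:M 0 0 P), (block_mx 1%:M 0 0 Q).
by split; rewrite !mulmx_block ?mul0mx ?mulmx0 ?add0r ?addr0 ?mul1mx ?mulmx1
  ?PQ ?QP ?PA -?scalar_mx_block.
Qed.

Lemma mx_similar_block_swap m n p (A : 'M[F]_m) (B : 'M[F]_n) (C : 'M[F]_p) :
  mx_similar (block_mx A 0 0 (block_mx B 0 0 C))
             (block_mx B 0 0 (block_mx A 0 0 C)).
Proof.
(* The permutation matrix exchanging the first two blocks. *)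
pose S a b c : 'M[F]_(b + (a + c), a + (b + c)) :=
  block_mx 0 (row_mx 1%:M 0) (col_mx 1%:M 0) (block_mx 0 0 0 1%:M).
have SS a b c : S a b c *m S b a c = 1%:M.
  rewrite /S mulmx_block !mul0mx !mulmx0 !add0r !mul_row_col mul_col_row.
  rewrite mul_block_col mulmx_block !mul1mx ?mulmx1 !mul0mx !addr0 ?add0r.
  rewrite add_block_mx !addr0 ?add0r.
  by rewrite -!scalar_mx_block row_mx0 col_mx0 -scalar_mx_block.
exists (S m n p), (S n m p); split=> //.
rewrite /S !mulmx_block !mul0mx !mulmx0 !add0r ?addr0.
rewrite !mul_row_block !mul_block_col mul_col_mx mul_mx_row.
by rewrite !mul1mx !mulmx1 !mul0mx !mulmx0 !addr0 ?add0r.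
Qed.

(** Any block can be pulled to the front by exchanging neighbours. *)
Lemma companion_sum_perm (fs gs : seq {poly F}) :
  perm_eq fs gs -> mx_similar (companion_sum fs) (companion_sum gs).
Proof.
have refl (s : seq {poly F}) : mx_similar (companion_sum s) (companion_sum s).
  by exists 1%:M, 1%:M; rewrite !mulmx1 mul1mx.
have pull (f : {poly F}) (s : seq {poly F}) :
    f \in s -> mx_similar (companion_sum s) (companion_sum (f :: rem f s)).
  elim: s => // g s IHs; rewrite inE /= eq_sym.
  have [-> _|_ f_s] := eqVneq g f; first exact: (refl (f :: s)).
  apply: mx_similar_trans (mx_similar_block_swap _ _ _).
  exact: mx_similar_block (IHs f_s).
elim: fs gs => [|f fs IHfs] gs.
  by move/perm_size/esym/size0nil->.
move=> fs_gs; have f_gs : f \in gs by rewrite -(perm_mem fs_gs) mem_head.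
apply: mx_similar_trans (mx_similar_sym (pull f gs f_gs)).
apply: mx_similar_block; apply: IHfs.
by rewrite -(perm_cons f) (permPl fs_gs) perm_to_rem.
Qed.

Lemma char_poly_companion_sum (fs : seq {poly F}) :
  (forall f, f \in fs -> f \is monic) ->
  char_poly (companion_sum fs) = \prod_(f <- fs) f.
Proof.
elim: fs => [|f fs IHfs] mon; first by rewrite big_nil /char_poly det_mx00.
rewrite big_cons /char_poly /= char_block_diag_mx det_ublock.
rewrite -![\det (char_poly_mx _)]/(char_poly _) companionmxK ?mon ?mem_head //.
by rewrite IHfs // => g g_fs; rewrite mon // inE g_fs orbT.
Qed.

Lemma mx_similar_dim m n (A : 'M[F]_m) (B : 'M[F]_n) : mx_similar A B -> m = n.
Proof.
have le k l (P : 'M[F]_(k, l)) Q : P *m Q = 1%:M -> (k <= l)%N.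
  by move=> PQ; rewrite -(mxrank1 F k) -PQ (leq_trans (mxrankM_maxl _ _)) ?rank_leq_col.
by move=> [P [Q [PQ QP _]]]; apply/eqP; rewrite eqn_leq (le _ _ _ _ QP) (le _ _ _ _ PQ).
Qed.

Lemma mx_similar_char_poly m n (A : 'M[F]_m) (B : 'M[F]_n) :
  mx_similar A B -> char_poly A = char_poly B.
Proof.
move=> simAB; have eq_mn := mx_similar_dim simAB.
case: _ / eq_mn in B simAB *; have [P [Q [PQ QP PA]]] := simAB.
have {PA}-> : B = P *m A *m Q by rewrite PA -mulmxA PQ mulmx1.
pose P' := map_mx polyC P; pose Q' := map_mx polyC Q.
have PQ' : P' *m Q' = 1%:M by rewrite -map_mxM PQ map_mx1.
rewrite /char_poly /char_poly_mx !map_mxM -/P' -/Q'.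
have -> : 'X%:M - P' *m map_mx polyC A *m Q' = P' *m ('X%:M - map_mx polyC A) *m Q'.
  by rewrite mulmxBr mulmxBl scalar_mxC -[in X in _ = X - _]mulmxA PQ' mulmx1.
by rewrite !det_mulmx mulrAC -det_mulmx PQ' det1 mul1r.
Qed.

End Similarity.

(** * Companion form of a matrix killed by a separable polynomial *)

Section CanonicalForm.
Variables (F : fieldType) (n : nat) (A : 'M[F]_n.+1).
Implicit Types (v w : 'rV[F]_n.+1) (f g h : {poly F}).

Definition cyclic_rows (d : nat) (v : 'rV[F]_n.+1) : 'M[F]_(d, n.+1) :=
  \matrix_(j < d) (v *m A ^+ j).

Lemma horner_mx_sum f d :
  (size f <= d)%N -> horner_mx A f = \sum_(j < d) f`_j *: A ^+ j.
Proof.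
move=> le_d; rewrite -{1}[f](poly_rV_K le_d) horner_rVpoly mulmx_sum_row linear_sum.
by apply: eq_bigr => i _; rewrite linearZ /= rowK mxvecK mxE.
Qed.

Lemma mul_cyclic_rows d (u : 'rV_d) v :
  u *m cyclic_rows d v = v *m horner_mx A (rVpoly u).
Proof.
rewrite (horner_mx_sum (size_poly _ _)) mulmx_sumr mulmx_sum_row.
by apply: eq_bigr => i _; rewrite rowK coef_rVpoly_ord -scalemxAr.
Qed.

(** Multiplication by [A] shifts the rows v, vA, vA^2, etc., and [f] expresses the
    image of the last one through the others. *)
Lemma cyclic_rows_companion v f :
  f \is monic -> (1 < size f)%N -> v *m horner_mx A f = 0 ->
  cyclic_rows (size f).-1 v *m A = companionmx f *m cyclic_rows (size f).-1 v.
Proof.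
move=> mon_f f_gt1 vf0; apply/row_matrixP => i.
rewrite !row_mul rowK -mulmxA -[A in _ *m (_ *m A)]/(A) mulmxE -exprSr -[A ^+ _]mul1r.
have [lt_i|ge_i] := ltnP i.+1 (size f).-1.
  have -> : row i (companionmx f) = delta_mx 0 i *m companionmx f by rewrite rowE.
  by rewrite mulmx_delta_companion -rowE rowK mul1r.
have def_i : i.+1 = (size f).-1 by apply/eqP; rewrite eqn_leq ge_i ltn_ord.
rewrite [RHS]mulmx_sum_row mul1r def_i.
move: vf0; rewrite (horner_mx_sum (leqSpred _)) big_ord_recr /= mulmxDr.
have -> : f`_(size f).-1 = 1 by apply/eqP; rewrite -monicE.
rewrite scale1r mulmx_sumr addrC => /eqP; rewrite addr_eq0 => /eqP->.
rewrite -sumrN; apply: eq_bigr => j _.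
have last_i : (i == (size f).-1.-1 :> nat) by apply/eqP; exact: (congr1 predn def_i).
by rewrite rowK !mxE last_i scaleNr -scalemxAr.
Qed.

Lemma stable_horner_mx m (U : 'M[F]_(m, n.+1)) v g :
  (U *m A <= U)%MS -> (v <= U)%MS -> (v *m horner_mx A g <= U)%MS.
Proof.
move=> UA; elim/poly_ind: g v => [|g c IHg] v vU; first by rewrite rmorph0 mulmx0 sub0mx.
rewrite rmorphD rmorphM /= horner_mx_X horner_mx_C mulmxDr addmx_sub //.
  by rewrite -[_ * A]/(_ *m A) mulmxA (submx_trans _ UA) // submxMr // IHg.
by rewrite mul_mx_scalar scalemx_sub.
Qed.

(** Split off an irreducible factor f of h = e f. As h is separable, e and f are
    coprime, and Bezout writes w as the sum of a vector killed by f and a vector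
    killed by e; one of them is outside [U], and in the second case the degree of
    the annihilator has dropped. *)
Lemma irreducible_vector_outside m (U : 'M[F]_(m, n.+1)) w h :
    (w *m horner_mx A h = 0) -> separable_poly h -> ~~ (w <= U)%MS ->
  exists v, exists f,
    [/\ monic_irreducible f, ~~ (v <= U)%MS & v *m horner_mx A f = 0].
Proof.
have [k] := ubnP (size h); elim: k w h => // k IHk w h /ltnSE le_k wh0 sep_h w_U.
have h0 := separable_poly_neq0 sep_h.
have [h_le1|h_gt1] := leqP (size h) 1.
  move: wh0 h0; rewrite (size1_polyC h_le1) horner_mx_C polyC_eq0 mul_mx_scalar.
  move/eqP; rewrite scalemx_eq0 => /orP[->//|/eqP w0].
  by rewrite w0 sub0mx in w_U.
have [f irr_f /dvdpP[e def_h]] := irreducible_factor_exists h_gt1.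
have [mon_f [f_gt1 _]] := irr_f.
move: sep_h; rewrite def_h separable_mul => /and3P[sep_e _ co_ef].
have /Bezout_eq1_coprimepP[[a b] /= ab1] := co_ef.
have split_w : w = w *m horner_mx A (a * e) + w *m horner_mx A (b * f).
  by rewrite -mulmxDr -rmorphD ab1 rmorph1 mulmx1.
(* The component along c p is killed by the complementary factor q. *)
have kill p q c : p * q = h -> w *m horner_mx A (c * p) *m horner_mx A q = 0.
  move=> pq; rewrite -mulmxA mulmxE -rmorphM -mulrA pq mulrC rmorphM /=.
  by rewrite -mulmxE mulmxA wh0 mul0mx.
have [in_U|out_U] := boolP (w *m horner_mx A (a * e) <= U)%MS; last first.
  by exists (w *m horner_mx A (a * e)), f; split=> //; apply: kill.
apply: (IHk (w *m horner_mx A (b * f)) e) => //.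
- apply: leq_trans le_k; rewrite def_h size_Mmonic ?separable_poly_neq0 //.
  by rewrite -subn1 -addnBA ?(ltnW f_gt1) // -[ltnLHS]addn0 ltn_add2l subn_gt0.
- by apply: kill; rewrite mulrC.
- by apply: contra w_U => ?; rewrite split_w addmx_sub.
Qed.

(** The cyclic subspace of [v] is a simple module over the polynomials, because
    [f] is irreducible: if it met [U] in a nonzero vector v g(A), then g would
    be invertible modulo [f] and [v] itself would be in [U]. *)
Lemma cyclic_extension_free m (U : 'M[F]_(m, n.+1)) v f :
    row_free U -> (U *m A <= U)%MS -> monic_irreducible f ->
    ~~ (v <= U)%MS -> v *m horner_mx A f = 0 ->
  row_free (col_mx (cyclic_rows (size f).-1 v) U).
Proof.
move=> U_free UA [mon_f irr_f] v_U vf0; apply: inj_row_free => u.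
rewrite -[u]hsubmxK mul_row_col mul_cyclic_rows.
set g := rVpoly _; move/eqP; rewrite addr_eq0 => /eqP vg_U.
have [g0|g0] := eqVneq g 0.
  have u1 : lsubmx u = 0 by rewrite -[lsubmx u]rVpolyK -/g g0 linear0.
  move: vg_U; rewrite g0 rmorph0 mulmx0 => /esym/eqP; rewrite oppr_eq0 => /eqP.
  move/(congr1 (mulmxr (pinvmx U))) => /=; rewrite mul0mx -mulmxA mulmxVp // mulmx1 => ->.
  by rewrite u1 row_mx0.
have co_fg : coprimep f g.
  rewrite irreducible_coprime //; apply/negP => /(dvdp_leq g0).
  have [f_gt1 _] := irr_f.
  by rewrite leqNgt (leq_ltn_trans (size_poly _ _)) // ltn_predL ltnW.
have /Bezout_eq1_coprimepP[[a b] /= ab1] := co_fg.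
case/negP: v_U; rewrite -[v]mulmx1 -[1%:M](rmorph1 (horner_mx A)) -ab1.
rewrite rmorphD mulmxDr [a * f]mulrC [b * g]mulrC !rmorphM /= -!mulmxE !mulmxA.
by rewrite vf0 mul0mx add0r stable_horner_mx // vg_U eqmx_opp submxMl.
Qed.

(** Cyclic subspaces are added one at a time until they fill the whole space. *)
Lemma separable_annihilator_companion h :
    separable_poly h -> horner_mx A h = 0 ->
  exists2 fs, forall f, f \in fs -> monic_irreducible f
            & mx_similar A (companion_sum fs).
Proof.
move=> sep_h Ah0.
(* k bounds the number of dimensions still to be filled. *)
suffices step k (fs : seq {poly F}) (P : 'M_(total_degree fs, n.+1)) :
    (n.+1 - total_degree fs < k)%N -> (forall f, f \in fs -> monic_irreducible f) ->
    row_free P -> P *m A = companion_sum fs *m P ->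
    exists2 gs, forall g, g \in gs -> monic_irreducible g
              & mx_similar A (companion_sum gs).
  apply: (step _ [::] 0 (leqnn _)) => //; last by rewrite mul0mx mulmx0.
  by rewrite /row_free mxrank0.
elim: k fs P => // k IHk fs P /ltnSE le_k irr_fs P_free PA.
have [P_full|] := boolP (row_full P).
  by exists fs => //; exists P, (pinvmx P); rewrite mulmxVp ?mulVpmx.
rewrite -sub1mx => /row_subPn[i w_P].
have PAP : (P *m A <= P)%MS by rewrite PA submxMl.
have [|v [f [irr_f v_P vf0]]] := irreducible_vector_outside _ sep_h w_P.
  by rewrite Ah0 mulmx0.
have [mon_f [f_gt1 _]] := irr_f.
have new_free := cyclic_extension_free P_free PAP irr_f v_P vf0.
apply: (IHk (f :: fs) (col_mx (cyclic_rows (size f).-1 v) P)) => //=.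
- have := new_free; rewrite -row_leq_rank => /leq_trans/(_ (rank_leq_col _)).
  by move: (total_degree fs) (size f) f_gt1 le_k => s d; lia.
- by move=> g; rewrite inE => /orP[/eqP->|/irr_fs].
- by rewrite mul_col_mx mul_block_col !mul0mx add0r addr0 PA cyclic_rows_companion.
Qed.

End CanonicalForm.

(** * Semisimplicity over a finite field *)

Section FiniteField.
Variable F : finFieldType.
Local Notation q := #|F|.

Lemma finField_prim_root (K : finFieldType) : exists z : K, #|K|.-1.-primitive_root z.
Proof.
have K_gt1 := finNzRing_gt1 K.
pose rs := [seq x <- enum K | x != 0].
have /hasP[z _ prim_z] : has #|K|.-1.-primitive_root rs; last by exists z.
apply: has_prim_root; first by rewrite -ltnS prednK // ltnW.
- apply/allP => x; rewrite mem_filter => /andP[x0 _]; apply/unity_rootP.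
  by apply: (mulfI x0); rewrite -exprS prednK ?expf_card ?mulr1 // ltnW.
- by rewrite filter_uniq ?enum_uniq.
by rewrite -(cardC1 (0 : K)) cardE /enum_mem -enumT.
Qed.

Lemma finField_card_pnat : exists2 p, p \in [pchar F] & p.-nat q.
Proof.
have [p _ charFp] := finPcharP F; exists p => //.
by rewrite -cardsT; exact: (pprimeChar_pgroup charFp).
Qed.

(** The extension is presented as a mere field morphism into a finite field, so
    that both the counting and the evaluation of polynomials apply to it. *)
Lemma simple_finite_extension (f : {poly F}) : irreducible_poly f ->
  exists (K : finFieldType) (iota : {rmorphism F -> K}) (z : K),
    [/\ #|K| = (q ^ (size f).-1)%N, root (map_poly iota f) z
      & forall x, exists g, x = (map_poly iota g).[z]].
Proof.
move=> irr_f; have [L dimL [z fz0 z_gen]] := irredp_FAdjoin irr_f.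
exists (finvect_type L), (in_alg (finvect_type L)), z; split=> //.
    rewrite -dimL; have <- := card_vspace (fullv : {vspace (finvect_type L)}).
  by apply: eq_card => x; rewrite memvf.
by move=> x; apply/Fadjoin1_polyP; rewrite z_gen memvf.
Qed.

Lemma map_poly_Frobenius (K : fieldType) (iota : {rmorphism F -> K}) g (x : K) i :
  (map_poly iota g).[x ^+ (q ^ i)] = (map_poly iota g).[x] ^+ (q ^ i).
Proof.
have [p charFp q_pnat] := finField_card_pnat.
have q_nat : [pchar K].-nat q.
  by apply: sub_in_pnat q_pnat => l _ /eqP->; apply: rmorph_pchar charFp.
elim: i => [|i IHi]; first by rewrite !expr1.
rewrite expnSr !exprM -{}IHi; move: (x ^+ _) => {i}x.
elim/poly_ind: g => [|g c IHg].
  by rewrite rmorph0 !horner0 expr0n; have := finNzRing_gt1 F; case: q.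
rewrite rmorphD rmorphM /= map_polyX map_polyC !hornerE IHg.
by rewrite exprDn_pchar // exprMn -[in RHS]rmorphXn expf_card.
Qed.

(** Both polynomials vanish at a root of [f] in the field with q^deg f elements,
    hence they are not coprime. *)
Lemma irreducible_dvd_XqX (f : {poly F}) : irreducible_poly f ->
  f %| 'X^(q ^ (size f).-1) - 'X.
Proof.
move=> irr_f; have [K [iota [z [cardK fz0 _]]]] := simple_finite_extension irr_f.
apply: contraT; rewrite -irreducible_coprime // => /Bezout_eq1_coprimepP[[a b] /= ab1].
have := congr1 (fun g => (map_poly iota g).[z]) ab1.
rewrite /= rmorph1 hornerC rmorphD !rmorphM rmorphB /= map_polyXn map_polyX.
rewrite !(hornerM, hornerE) (rootP fz0) -cardK expf_card subrr !mulr0 addr0.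
by move/esym/eqP; rewrite oner_eq0.
Qed.

(** The derivative of X^N - X is -1 when N is a power of the characteristic. *)
Lemma irreducible_separable (f : {poly F}) : irreducible_poly f -> separable_poly f.
Proof.
move=> irr_f; apply: dvdp_separable (irreducible_dvd_XqX irr_f) _.
have [f_gt1 _] := irr_f; rewrite separable_poly.unlock.
set N := (q ^ _)%N; have N0 : N%:R = 0 :> F.
  have [p charFp q_pnat] := finField_card_pnat; apply/eqP.
  rewrite -(dvdn_pcharf charFp) /N Euclid_dvdX ?(pcharf_prime charFp) //.
  rewrite -subn1 subn_gt0 f_gt1 andbT.
  have [[|k] def_q] := p_natP q_pnat; last by rewrite def_q expnS dvdn_mulr.
  by have := finNzRing_gt1 F; rewrite def_q.
rewrite derivB derivXn derivX -scaler_nat N0 scale0r sub0r.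
by rewrite -[X in coprimep _ X]scaleN1r coprimepZr ?coprimep1 // oppr_eq0 oner_eq0.
Qed.

Lemma separable_prod_irreducible (fs : seq {poly F}) :
    uniq fs -> (forall f, f \in fs -> monic_irreducible f) ->
  separable_poly (\prod_(f <- fs) f).
Proof.
elim: fs => [|f fs IHfs] /=.
  by move=> _ _; rewrite big_nil separable_poly.unlock /separable_poly.body coprime1p.
move=> /andP[f_fs uniq_fs] irr_fs.
have irr_f := irr_fs f (mem_head _ _).
have irr_fs' g : g \in fs -> monic_irreducible g.
  by move=> g_fs; apply: irr_fs; rewrite inE g_fs orbT.
have [_ irrf] := irr_f.
rewrite big_cons separable_mul irreducible_separable // IHfs //=.
rewrite irreducible_coprime //; apply: contra f_fs.
move=> /(irreducible_dvd_prod irrf)[g g_fs fg].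
by rewrite (monic_irreducible_dvd_eq irr_f (irr_fs' g g_fs) fg).
Qed.

(** The minimal polynomial does not change under field extension, and a matrix
    is diagonalizable when this polynomial is a product of distinct linear
    factors; a splitting field provides the extension for the converse. *)
Lemma semisimple_minpoly n (A : 'M[F]_n.+1) :
  semisimple A <-> separable_poly (mxminpoly A).
Proof.
split=> [[L /diagonalizableP[rs uniq_rs dv_rs]]|sep_A].
  rewrite -(separable_map (in_alg L)) -mxminpoly_map.
  by apply: dvdp_separable dv_rs _; rewrite separable_prod_XsubC.
have [L [rs eq_rs _]] := FinSplittingFieldFor (separable_poly_neq0 sep_A).
exists L; apply/diagonalizableP; exists rs;
  last by rewrite mxminpoly_map -(eqp_dvdr _ eq_rs) dvdpp.
by rewrite -separable_prod_XsubC -(eqp_separable eq_rs) separable_map.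
Qed.

Lemma intertwiner_Cayley_Hamilton n d (A : 'M[F]_n.+1) (C : 'M[F]_d)
    (P : 'M[F]_(d, n.+1)) :
  P *m A = C *m P -> P *m horner_mx A (char_poly C) = 0.
Proof.
case: d => [|d] in C P *; first by move=> _; rewrite [P]flatmx0 mul0mx.
move=> PA; suffices comm_P g : P *m horner_mx A g = horner_mx C g *m P.
  by rewrite comm_P Cayley_Hamilton mul0mx.
elim/poly_ind: g => [|g c IHg]; first by rewrite !rmorph0 mulmx0 mul0mx.
rewrite !rmorphD !rmorphM /= !horner_mx_X !horner_mx_C mulmxDr mulmxDl -!mulmxE.
by rewrite mulmxA IHg -!mulmxA PA scalar_mxC.
Qed.

(** Each block is killed by its polynomial (Cayley-Hamilton), hence the whole
    matrix is killed by the product of the distinct factors, which is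
    separable. *)
Lemma companion_sum_semisimple n (A : 'M[F]_n.+1) (fs : seq {poly F}) :
    (forall f, f \in fs -> monic_irreducible f) ->
  mx_similar A (companion_sum fs) -> semisimple A.
Proof.
move=> irr_fs [P [Q [PQ QP PA]]]; apply/semisimple_minpoly.
pose h := \prod_(f <- undup fs) f.
have sep_h : separable_poly h.
  by apply: separable_prod_irreducible (undup_uniq _) _ => f; rewrite mem_undup => /irr_fs.
apply: dvdp_separable sep_h; apply: mxminpoly_min.
rewrite -[LHS]mul1mx -QP -mulmxA.
suffices -> : P *m horner_mx A h = 0 by rewrite mulmx0.
have : forall f, f \in fs -> f %| h.
  move=> f f_fs; rewrite /h (big_rem f) ?mem_undup //=; exact: dvdp_mulr.
clearbody h; clear Q PQ QP; elim: fs => [|f fs IHfs] in irr_fs P PA *.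
  by move=> _; rewrite [P]flatmx0 mul0mx.
move=> /= dv_h; rewrite -[P]vsubmxK in PA *.
move: (usubmx P) (dsubmx P) PA => /= Pu Pd.
rewrite mul_block_col !mul_col_mx !mul0mx add0r addr0 => /eq_col_mx[PAu PAd].
rewrite (IHfs _ _ PAd) => [|g g_fs|g g_fs]; last 2 first.
- by apply: irr_fs; rewrite inE g_fs orbT.
- by apply: dv_h; rewrite inE g_fs orbT.
have := intertwiner_Cayley_Hamilton PAu.
have [mon_f _] := irr_fs f (mem_head _ _); rewrite companionmxK // => Pf0.
have /dvdpP[e ->] := dv_h f (mem_head _ _).
by rewrite mulrC rmorphM /= -mulmxE mulmxA Pf0 mul0mx col_mx0.
Qed.

Lemma semisimple_companion n (A : 'M[F]_n.+1) : semisimple A ->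
  exists2 fs, forall f, f \in fs -> monic_irreducible f
            & mx_similar A (companion_sum fs).
Proof.
move=> /semisimple_minpoly sep_A.
exact: separable_annihilator_companion sep_A (mx_root_minpoly _).
Qed.

Lemma semisimple_char_poly_exists n (p : {poly F}) :
  p \is monic -> size p = n.+2 -> exists2 A : 'M[F]_n.+1, semisimple A & char_poly A = p.
Proof.
move=> mon_p sz_p; have [fs irr_fs def_p] := monic_factorization mon_p.
have chi_p : char_poly (companion_sum fs) = p.
  by rewrite char_poly_companion_sum // => f /irr_fs[].
have eq_n : total_degree fs = n.+1.
  by apply/eqP; rewrite -eqSS -sz_p -chi_p size_char_poly.
have [A simA] : exists A : 'M[F]_n.+1, mx_similar A (companion_sum fs).
  move: (companion_sum fs); case: _ / eq_n => B.
  by exists B, 1%:M, 1%:M; rewrite !mul1mx mulmx1.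
exists A; first exact: companion_sum_semisimple irr_fs simA.
by rewrite (mx_similar_char_poly simA).
Qed.

End FiniteField.

(** * Determinants on the centralizer of a companion matrix *)

Section NormSurjectivity.
Variable F : finFieldType.
Local Notation q := #|F|.

(** The roots of an irreducible polynomial are the conjugates of one of them
    under the Frobenius map. They are distinct: if z^(q^k) = z with 0 < k < d,
    then the whole field generated by z, which has q^d elements, would consist
    of roots of X^(q^k) - X. *)
Lemma conjugates_split (K : finFieldType) (iota : {rmorphism F -> K})
    (z : K) (f : {poly F}) :
    f \is monic -> (1 < size f)%N -> #|K| = (q ^ (size f).-1)%N ->
    root (map_poly iota f) z ->
    (forall x, exists g, x = (map_poly iota g).[z]) ->
  let rs := mkseq (fun i => z ^+ (q ^ i)) (size f).-1 in
  uniq rs /\ map_poly iota f = \prod_(r <- rs) ('X - r%:P).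
Proof.
move=> mon_f f_gt1 cardK fz0 z_gen rs; set d := (size f).-1 in rs cardK *.
have q_gt1 := finNzRing_gt1 F.
have uniq_rs : uniq rs.
  apply/mkseq_uniqP => i j; rewrite !inE.
  wlog le_ij : i j / (i <= j)%N.
    by move=> IH; case: (leqP i j) => [|/ltnW] le lt_i lt_j eq_z; [|symmetry]; apply: IH.
  move=> lt_i lt_j eq_z; apply/eqP; rewrite eqn_leq le_ij -subn_eq0 /=.
  have lt_k : (j - i < d)%N by apply: leq_ltn_trans (leq_subr _ _) lt_j.
  rewrite -leqn0 leqNgt; apply/negP => k_gt0.
  (* Raising to the power q^(d - i) undoes the i-th Frobenius, as z^(q^d) = z. *)
  have {}eq_z : z ^+ (q ^ (j - i)) = z.
    rewrite -[RHS]expf_card -[LHS]expf_card cardK -(subnKC (ltnW lt_i)).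
    by rewrite expnD !exprM -[_ ^+ _ ^+ (q ^ i)]exprM -expnD subnK // eq_z.
  have fixK (x : K) : x ^+ (q ^ (j - i)) = x.
    by have [g ->] := z_gen x; rewrite -map_poly_Frobenius eq_z.
  pose h : {poly K} := 'X^(q ^ (j - i)) - 'X.
  have sz_h : size h = (q ^ (j - i)).+1.
    rewrite size_polyDl ?size_polyXn // size_polyN size_polyX ltnS (leq_trans q_gt1) //.
    by rewrite -{1}[q]expn1 leq_exp2l.
  have h0 : h != 0 by rewrite -size_poly_eq0 sz_h.
  have h_roots : all (root h) (enum K).
    by apply/allP => x _; rewrite /root !hornerE ?hornerXn fixK subrr.
  have := max_poly_roots h0 h_roots (enum_uniq _).
  by rewrite sz_h -cardE cardK ltnS leq_exp2l // leqNgt lt_k.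
split=> //; rewrite [LHS](@all_roots_prod_XsubC _ _ rs) ?uniq_rootsE //.
- by rewrite lead_coef_map (monicP mon_f) rmorph1 scale1r.
- by rewrite size_map_poly size_mkseq prednK // ltnW.
apply/allP => _ /mapP[i _ ->]; rewrite /root map_poly_Frobenius (rootP fz0).
by rewrite expr0n gtn_eqF // expn_gt0 ltnW.
Qed.

(** Over the splitting field [A] is diagonal with the given roots as entries, so
    this is the formula for the norm as a product of conjugates. *)
Lemma det_horner_conjugates (K : fieldType) (iota : {rmorphism F -> K}) n
    (A : 'M[F]_n.+1) (rs : seq K) (g : {poly F}) :
    uniq rs -> map_poly iota (char_poly A) = \prod_(r <- rs) ('X - r%:P) ->
  iota (\det (horner_mx A g)) = \prod_(r <- rs) (map_poly iota g).[r].
Proof.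
move=> uniq_rs def_rs.
have [P P_unit /diagonalizable_forPex[D /(simmxRL P_unit) def_D]] :
  diagonalizable (map_mx iota A).
  apply/diagonalizableP; exists rs => //.
  by rewrite -def_rs mxminpoly_map dvdp_map mxminpoly_dvd_char.
have rs_D : perm_eq rs [seq D 0 i | i <- enum 'I_n.+1].
  apply: prod_XsubC_eq; rewrite -def_rs map_char_poly big_map big_enum /=.
  have -> : char_poly (map_mx iota A) = char_poly (diag_mx D).
    apply: mx_similar_char_poly; exists P, (invmx P).
    by rewrite mulmxV // mulVmx // def_D mulmxKV.
  rewrite char_poly_trig ?diag_mx_is_trig //.
  by apply: eq_bigr => i _; rewrite mxE eqxx.
rewrite (perm_big _ rs_D) big_map big_enum /= -det_map_mx map_horner_mx.
have := horner_mx_diag D (map_poly iota g); rewrite def_D horner_mx_uconj //.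
move/(congr1 determinant); rewrite !det_mulmx mulrAC -det_mulmx mulmxV //
  det1 mul1r => ->.
by rewrite det_diag; apply: eq_bigr => i _; rewrite mxE.
Qed.

(** Take for [g] the polynomial giving a generator w of the multiplicative group
    of the extension. The determinant of g(A) is the norm
    w^(1 + q + q^2 + ...), of order (q^d - 1) / (1 + q + q^2 + ...) = q - 1, so
    its powers are all the nonzero scalars. *)
Lemma centralizer_det_surjective n (A : 'M[F]_n) (a : F) :
    monic_irreducible (char_poly A) -> a != 0 ->
  exists2 C : 'M[F]_n, C *m A = A *m C & \det C = a.
Proof.
case: n A => [|n] A [mon_f irr_f] a0.
  by have [] := irr_f; rewrite size_char_poly.
have [f_gt1 _] := irr_f.
have [K [iota [z [cardK fz0 z_gen]]]] := simple_finite_extension irr_f.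
have [uniq_rs def_rs] := conjugates_split mon_f f_gt1 cardK fz0 z_gen.
have q_gt1 := finNzRing_gt1 F.
have [w prim_w] := finField_prim_root K; have [g def_w] := z_gen w.
pose b := \det (horner_mx A g).
have def_b : iota b = w ^+ (\sum_(i < n.+1) q ^ i).
  rewrite (det_horner_conjugates g uniq_rs def_rs) big_map size_char_poly.
  rewrite -[seq.iota 0 _]/(index_iota 0 n.+1) big_mkord expr_sum def_w.
  by apply: eq_bigr => i _; rewrite map_poly_Frobenius.
have prim_b : q.-1.-primitive_root b.
  rewrite -(fmorph_primitive_root iota) def_b.
  have S_gt0 : (0 < \sum_(i < n.+1) q ^ i)%N.
    by rewrite big_ord_recl addn_gt0 expn0.
  have := dvdn_prim_root prim_w (_ : q.-1 %| #|K|.-1)%N.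
  rewrite cardK size_char_poly /= predn_exp dvdn_mulr // mulKn; first exact.
  by rewrite -ltnS prednK // ltnW.
have a_unity : a ^+ q.-1 = 1.
  by apply: (mulfI a0); rewrite -exprS prednK ?expf_card ?mulr1 // ltnW.
have [k ->] := prim_rootP prim_b a_unity.
exists (horner_mx A g ^+ k); last first.
  by elim: (k : nat) => [|m IHm]; rewrite ?det1 // !exprS -IHm -mulmxE det_mulmx.
rewrite -rmorphXn -[X in _ *m X = X *m _]horner_mx_X.
exact: (comm_horner_mx2 A (g ^+ k) 'X).
Qed.

End NormSurjectivity.

(** * Characteristic polynomials of semisimple classes *)

Section SpecialLinearClasses.
Variable F : finFieldType.

Lemma companion_sum_centralizer_det (fs : seq {poly F}) (a : F) :
    (forall f, f \in fs -> monic_irreducible f) -> (0 < total_degree fs)%N -> a != 0 ->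
  exists2 C, C *m companion_sum fs = companion_sum fs *m C & \det C = a.
Proof.
case: fs => // f fs irr_fs _ a0; have irr_f := irr_fs f (mem_head _ _).
have chi_f := companionmxK (proj1 irr_f).
have [|C commC detC] := @centralizer_det_surjective _ _ (companionmx f) a _ a0.
  by rewrite chi_f.
(* The first block alone already realizes all determinants. *)
exists (block_mx C 0 0 1%:M); last by rewrite det_ublock det1 mulr1.
by rewrite /= !mulmx_block !mul0mx !mulmx0 mul1mx mulmx1 !add0r !addr0 commC.
Qed.

(** A matrix conjugating [A] to [B] may be multiplied by any invertible element
    of the centralizer of [A], which lets one reach determinant 1. *)
Lemma semisimple_char_poly_similar n (A B : 'M[F]_n.+1) :
    semisimple A -> semisimple B -> char_poly A = char_poly B ->
  exists2 P : 'M[F]_n.+1, \det P = 1 & P *m A = B *m P.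
Proof.
move=> ssA ssB eq_chi; have [fs irr_fs simA] := semisimple_companion ssA.
have [gs irr_gs simB] := semisimple_companion ssB.
have fs_gs : perm_eq fs gs.
  apply: factorization_unique => //; rewrite -!char_poly_companion_sum; last 2 first.
  - by move=> g /irr_gs[].
  - by move=> f /irr_fs[].
  by rewrite -(mx_similar_char_poly simA) eq_chi (mx_similar_char_poly simB).
have [P [Q [PQ QP PA]]] : mx_similar A B.
  apply: mx_similar_trans simA _; apply: mx_similar_trans (companion_sum_perm fs_gs) _.
  exact: mx_similar_sym.
have detP : \det P != 0.
  by apply: contra_eq_neq (congr1 determinant PQ) => P0;
    rewrite det_mulmx P0 mul0r det1 eq_sym oner_eq0.
have [C commC detC] : exists2 C, C *m A = A *m C & \det C = (\det P)^-1.
  have dim_fs := mx_similar_dim simA.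
  have [||C] := @companion_sum_centralizer_det fs (\det P)^-1 irr_fs.
  - by rewrite -dim_fs.
  - by rewrite invr_eq0.
  move: (companion_sum fs) simA; case: _ / dim_fs C => C D [R [S [RS SR RA]]] commC detC.
  exists (S *m C *m R); last by rewrite !det_mulmx mulrAC -det_mulmx SR det1 mul1r.
  rewrite -!mulmxA RA !mulmxA -(mulmxA S) commC !mulmxA; congr (_ *m _ *m _).
  by rewrite -[RHS]mul1mx -SR -!mulmxA (mulmxA R) RA -(mulmxA D) RS mulmx1.
exists (P *m C); first by rewrite det_mulmx detC mulfV.
by rewrite -mulmxA commC !mulmxA PA.
Qed.

Lemma mem_ss_class n (c : {set {'GL_n.+1[F]}}) : c \in ss_classes F n.+1 ->
  exists u, [/\ \det (GLval u) = 1, semisimple (GLval u) & c = (u ^: SL_set F n.+1)%g].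
Proof.
move=> /imsetP[u]; rewrite inE => /andP[]; rewrite inE => /eqP det_u /asboolP ss_u ->.
by exists u.
Qed.

Lemma mem_SL_class n (u : {'GL_n.+1[F]}) : u \in (u ^: SL_set F n.+1)%g.
Proof. exact (class_refl (SL_group F n.+1) u). Qed.

Lemma SL_class_GLval n (u v : {'GL_n.+1[F]}) : v \in (u ^: SL_set F n.+1)%g ->
  char_poly (GLval v) = char_poly (GLval u) /\ \det (GLval v) = \det (GLval u).
Proof.
move=> /imsetP[x _ ->]; suffices sim : mx_similar (GLval (u ^ x)%g) (GLval u).
  split; first exact: mx_similar_char_poly.
  apply: (@mulfI _ ((-1) ^+ n.+1)); rewrite ?signr_eq0 //.
  by rewrite -!char_poly_det (mx_similar_char_poly sim).
exists (GLval x), (GLval x^-1%g); rewrite -!GL_MxE mulgV mulVg.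
by split=> //; rewrite conjgE mulKVg.
Qed.

Definition class_char_poly n (c : {set {'GL_n.+1[F]}}) : {poly F} :=
  char_poly (GLval (repr c)).

Lemma class_char_polyE n (c : {set {'GL_n.+1[F]}}) u :
  c \in ss_classes F n.+1 -> u \in c ->
  class_char_poly c = char_poly (GLval u).
Proof.
move=> /mem_ss_class[v [_ _ ->]] u_c.
have [-> _] := SL_class_GLval u_c.
by have [] := SL_class_GLval (mem_repr u u_c).
Qed.

Lemma class_char_poly_inj n : {in ss_classes F n.+1 &, injective (@class_char_poly n)}.
Proof.
move=> c d ss_c ss_d; have [u [det_u ss_u def_c]] := mem_ss_class ss_c.
have [v [det_v ss_v def_d]] := mem_ss_class ss_d.
have u_c : u \in c by rewrite def_c mem_SL_class.
have v_d : v \in d by rewrite def_d mem_SL_class.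
rewrite (class_char_polyE ss_c u_c) (class_char_polyE ss_d v_d) => eq_chi.
have [P detP PA] := semisimple_char_poly_similar ss_u ss_v eq_chi.
have P_unit : P \is a GRing.unit.
  by rewrite -[_ \is a _]/(P \in unitmx) unitmxE detP unitr1.
pose x : {'GL_n.+1[F]} := FinRing.unit _ P_unit.
have x_SL : x \in SL_group F n.+1 by rewrite inE /= detP.
have def_u : u = (v ^ x)%g.
  rewrite conjgE; apply: (mulgI x); rewrite mulKVg; apply: val_inj.
  exact: PA.
by rewrite def_c def_d def_u; exact (classGidl v x_SL).
Qed.

Lemma class_char_poly_surj n (p : {poly F}) :
    p \is monic -> size p = n.+2 -> p`_0 = (-1) ^+ n.+1 ->
  exists2 c, c \in ss_classes F n.+1 & class_char_poly c = p.
Proof.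
move=> mon_p sz_p p0; have [A ssA chiA] := semisimple_char_poly_exists mon_p sz_p.
have detA : \det A = 1.
  apply: (@mulfI _ ((-1) ^+ n.+1)); first by rewrite signr_eq0.
  by rewrite -char_poly_det chiA p0 mulr1.
have A_unit : A \is a GRing.unit.
  by rewrite -[_ \is a _]/(A \in unitmx) unitmxE detA unitr1.
pose u : {'GL_n.+1[F]} := FinRing.unit _ A_unit.
have ss_u : (u ^: SL_set F n.+1)%g \in ss_classes F n.+1.
  by apply: imset_f; rewrite !inE /= detA eqxx; apply/asboolP.
exists (u ^: SL_set F n.+1)%g => //.
rewrite (class_char_polyE ss_u (_ : u \in _)) //.
exact: mem_SL_class.
Qed.

Lemma class_char_poly_spec n (c : {set {'GL_n.+1[F]}}) : c \in ss_classes F n.+1 ->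
  [/\ class_char_poly c \is monic, size (class_char_poly c) = n.+2
    & (class_char_poly c)`_0 = (-1) ^+ n.+1].
Proof.
move=> ss_c; have [u [det_u ss_u def_c]] := mem_ss_class ss_c.
have u_c : u \in c by rewrite def_c mem_SL_class.
rewrite (class_char_polyE ss_c u_c) char_poly_monic size_char_poly char_poly_det
  det_u mulr1.
by [].
Qed.

End SpecialLinearClasses.

(** * Sum-zero windows and residues *)

Definition decreasing (s : seq int) : bool := sorted [rel x y : int | y <= x] s.

(** Up to the condition on the sum, these are the blocks of consecutive terms,
    as many as the period, of the decreasing sequences u with
    u_(i+n) = u_i - m, where n is the size of [s]. *)
Definition window (m : int) (s : seq int) : Prop :=
  [/\ decreasing s, \sum_(x <- s) x = 0
    & forall x y, x \in s -> y \in s -> x - y <= m].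

(** The block of the same periodic sequence whose values lie between 0 and m - 1. *)
Definition wrap (m : int) (s : seq int) : seq int :=
  [seq x + m | x <- s & x < 0] ++ [seq x <- s | 0 <= x].

Section Windows.
Variable m : int.
Hypothesis m_gt0 : 0 < m.

Let ge_transitive : transitive [rel x y : int | y <= x].
Proof. by move=> y x z /= yx zy; apply: le_trans zy yx. Qed.

Lemma decreasing_perm_eq s t : decreasing s -> decreasing t -> perm_eq s t -> s = t.
Proof.
by apply: sorted_eq => // x y /= xy; apply/le_anti; rewrite andbC.
Qed.

Lemma decreasing_cat s t : decreasing (s ++ t) =
  [&& allrel [rel x y : int | y <= x] s t, decreasing s & decreasing t].
Proof. by rewrite /decreasing !sorted_pairwise // pairwise_cat. Qed.

Lemma decreasing_shift c s : decreasing [seq x + c | x <- s] = decreasing s.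
Proof. by rewrite /decreasing sorted_map; apply: eq_sorted => x y /=; rewrite lerD2r. Qed.

Lemma window_bound s x : window m s -> x \in s -> - m < x < m.
Proof.
move=> [_ sum0 width] x_s.
have sum_rem : \sum_(y <- rem x s) y = - x.
  by apply/eqP; rewrite -addr_eq0 addrC -[x + _](big_rem x (P := predT) (F := id)) ?sum0.
have rem_s y : y \in rem x s -> y \in s by apply: mem_rem.
apply/andP; split; rewrite ltNge; apply/negP => le_x.
  have : \sum_(y <- rem x s) y <= 0; last by rewrite sum_rem; lia.
  rewrite big_seq sumr_le0 // => y /rem_s y_s; have := width _ _ y_s x_s; lia.
have : 0 <= \sum_(y <- rem x s) y; last by rewrite sum_rem; lia.
rewrite big_seq sumr_ge0 // => y /rem_s y_s; have := width _ _ x_s y_s; lia.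
Qed.

Lemma decreasing_split s : decreasing s ->
  s = [seq x <- s | 0 <= x] ++ [seq x <- s | x < 0].
Proof.
move=> dec_s; apply: decreasing_perm_eq => //.
  rewrite decreasing_cat /decreasing !sorted_filter // !andbT.
  apply/allrelP => x y; rewrite !mem_filter => /andP[x0 _] /andP[y0 _].
  exact: le_trans (ltW y0) x0.
rewrite perm_sym (@eq_filter _ (fun x => x < 0) (predC (fun x : int => 0 <= x))).
  by rewrite perm_filterC.
by move=> x /=; rewrite ltNge.
Qed.

Lemma wrap_decreasing s : window m s -> decreasing (wrap m s).
Proof.
move=> win_s; have [dec_s _ width] := win_s.
rewrite /wrap decreasing_cat decreasing_shift /decreasing !sorted_filter // !andbT.
apply/allrelP => _ y /mapP[x + ->] /=; rewrite !mem_filter => /andP[_ x_s] /andP[_ y_s].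
by have := width _ _ y_s x_s; lia.
Qed.

Lemma wrap_mod s : window m s -> perm_eq (wrap m s) [seq (x %% m)%Z | x <- s].
Proof.
move=> win_s; rewrite perm_sym [X in perm_eq [seq _ | _ <- X] _]decreasing_split;
  last by case: win_s.
rewrite map_cat perm_catC.
rewrite (_ : [seq (x %% m)%Z | x <- s & 0 <= x] = [seq x <- s | 0 <= x]).
  rewrite (_ : [seq (x %% m)%Z | x <- s & x < 0] = [seq x + m | x <- s & x < 0]) //.
  apply/eq_in_map => x; rewrite mem_filter => /andP[x0 /(window_bound win_s)].
  by move=> bd; rewrite -modzDr modz_small //; lia.
rewrite -[RHS]map_id; apply/eq_in_map => x; rewrite mem_filter.
move=> /andP[x0 /(window_bound win_s) bd]; rewrite modz_small //; lia.
Qed.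

(** Moving a window by one place changes its sum by [m]; hence the number of
    negative terms of a sum-zero window is known from its residues, and the
    window can be recovered. *)
Lemma wrap_sum s : window m s ->
  \sum_(x <- wrap m s) x = m * (size [seq x <- s | x < 0])%:Z.
Proof.
move=> [dec_s sum0 _]; move: sum0; rewrite {1}(decreasing_split dec_s) /wrap !big_cat /=.
rewrite big_map big_split /= big_const_seq count_predT iter_addr_0 -mulr_natr.
by move=> sum0; rewrite addrAC [X in X + _]addrC sum0 add0r natz.
Qed.

Lemma window_mod_inj s t : window m s -> window m t ->
  perm_eq [seq (x %% m)%Z | x <- s] [seq (x %% m)%Z | x <- t] -> s = t.
Proof.
move=> win_s win_t eq_mod; have [dec_s _ _] := win_s; have [dec_t _ _] := win_t.
have eq_wrap : wrap m s = wrap m t.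
  apply: decreasing_perm_eq; rewrite ?wrap_decreasing //.
  by rewrite (permPl (wrap_mod win_s)) (permPr (wrap_mod win_t)).
have eq_sz : size [seq x <- s | x < 0] = size [seq x <- t | x < 0].
  have := wrap_sum win_t; rewrite -eq_wrap wrap_sum // => /(mulfI (lt0r_neq0 m_gt0)).
  by case.
move/eqP: eq_wrap; rewrite /wrap eqseq_cat ?size_map // => /andP[/eqP eq_neg /eqP eq_pos].
rewrite (decreasing_split dec_s) (decreasing_split dec_t) eq_pos; congr (_ ++ _).
exact: inj_map (addIr m) _ _ eq_neg.
Qed.

(** Sort the least nonnegative representatives of the residues; their sum is t m for some
    t. Subtracting [m] from the t largest ones gives a sum-zero window. *)
Lemma window_mod_surj r :
    (forall x, x \in r -> 0 <= x < m) -> (m %| \sum_(x <- r) x)%Z ->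
  exists2 s, window m s & perm_eq [seq (x %% m)%Z | x <- s] r.
Proof.
wlog dec_r : r / decreasing r.
  move=> IH r_bd dv_r; pose r' := sort [rel x y : int | y <= x] r.
  have perm_r : perm_eq r' r by rewrite perm_sort.
  have [|x||s win_s mod_s] := IH r'.
  - by apply: sort_sorted => x y /=; apply: le_total.
  - by rewrite mem_sort; apply: r_bd.
  - by rewrite (perm_big _ perm_r).
  by exists s; rewrite // -(permPr perm_r).
move=> r_bd /dvdzP[t' sum_r].
have sum_ge0 : 0 <= \sum_(x <- r) x.
  by rewrite big_seq sumr_ge0 // => x /r_bd/andP[].
have [t def_t] : exists t : nat, t' = t%:Z by exists `|t'|%N; nia.
rewrite {t'}def_t in sum_r.
have sum_le : \sum_(x <- r) x <= (size r)%:Z * m.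
  rewrite -natz mulr_natl -[size r]count_predT -iter_addr_0 -big_const_seq.
  by rewrite !big_seq ler_sum // => x /r_bd/andP[_ /ltW].
have t_le : (t <= size r)%N by nia.
have cat_r := cat_take_drop t r.
have bdT x : x \in take t r -> 0 <= x < m by move/mem_take/r_bd.
have bdD x : x \in drop t r -> 0 <= x < m by move/mem_drop/r_bd.
move: dec_r; rewrite -cat_r decreasing_cat => /and3P[/allrelP geTD decT decD].
exists (drop t r ++ [seq x - m | x <- take t r]); last first.
  rewrite map_cat perm_catC -map_comp !map_id_in // => x /=.
    by move/bdD => bd; rewrite modz_small //; lia.
  by move/bdT => bd; rewrite -modzDr subrK modz_small //; lia.
split.
- rewrite decreasing_cat decreasing_shift decT decD !andbT.
  apply/allrelP => x _ /bdD bx /mapP[y /bdT by_ ->] /=; lia.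
- rewrite big_cat big_map big_split /= big_const_seq count_predT iter_addr_0.
  rewrite size_takel // addrCA addrA -[X in X + _]/(_ + _) -big_cat cat_r sum_r.
  by rewrite -mulr_natl natz mulrN subrr.
move=> x y; rewrite !mem_cat => /orP[xD|/mapP[x' xT ->]] /orP[yD|/mapP[y' yT ->]].
- by have := bdD _ xD; have := bdD _ yD; lia.
- by have := geTD _ _ yT xD; rewrite /=; lia.
- by have := bdT _ xT; have := bdD _ yD; lia.
- by have := bdT _ xT; have := bdT _ yT; lia.
Qed.

End Windows.

(** * Cellini vectors and split polynomials *)

Section Cellini.
Variables n q : nat.
Hypothesis n_gt0 : (0 < n)%N.

Lemma nth_codom_ffun (v : {ffun 'I_n.+1 -> int}) (i : 'I_n.+1) : (codom v)`_i = v i.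
Proof. by rewrite (nth_map i) ?size_enum_ord // nth_ord_enum. Qed.

(** For the identity permutation there is no descent except the cyclic one, from
    the last point back to the first; this sharpens the bound q on the width
    to q - 1. *)
Lemma cellini_vectors_window (v : {ffun 'I_n.+1 -> int}) :
  cellini_vectors q 1%g v <-> window (q%:Z - 1) (codom v).
Proof.
have sum_v : \sum_(x <- codom v) x = \sum_i v i by rewrite big_map big_enum.
have sz_v : size (codom v) = n.+1 by rewrite size_codom card_ord.
split=> [[sum0 [dec wid] _ strict]|[dec sum0 wid]].
  have {}dec : decreasing (codom v).
    apply/(sortedP 0) => i; rewrite sz_v => lt_i /=.
    by have := dec (Ordinal (ltnW lt_i)) (Ordinal lt_i) erefl; rewrite -!nth_codom_ffun.
  split=> //; first by rewrite sum_v.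
  have mono (i j : 'I_n.+1) : (i <= j)%N -> v j <= v i.
    move=> le_ij; rewrite -!nth_codom_ffun.
    have := @sorted_leq_nth _ [rel x y : int | y <= x] _ _ 0 _ dec i j.
    apply=> //; rewrite ?inE ?sz_v //; last by move=> x /=.
    by move=> y x z /= yx zy; apply: le_trans zy yx.
  move=> _ _ /codomP[i ->] /codomP[j ->].
  have := strict ord0 ord_max erefl erefl; rewrite !perm1 => /(_ n_gt0).
  have := mono ord0 i (leq0n i); have := mono j ord_max (leq_ord j); lia.
split.
- by rewrite -sum_v.
- split=> i j; last by have := wid _ _ (codom_f v i) (codom_f v j); lia.
  move=> def_j; rewrite -!nth_codom_ffun def_j.
  by move/(sortedP 0): dec => /(_ i); rewrite sz_v -def_j => /(_ (ltn_ord j)).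
- by move=> i j def_j; rewrite !perm1 def_j => /ltnW; rewrite ltnn.
- by move=> i j _ _ _; have := wid _ _ (codom_f v i) (codom_f v j); lia.
Qed.

End Cellini.

Section DiscreteLogarithm.
Variables (F : finFieldType) (g : F).
Local Notation q := #|F|.
Hypothesis prim_g : q.-1.-primitive_root g.

Let logs : seq F := [seq g ^+ i | i <- iota 0 q.-1].

Definition discrete_log (y : F) : int := index y logs.

Let q1E : q%:Z - 1 = q.-1%:Z.
Proof. by rewrite -subn1 -subzn // ltnW ?finNzRing_gt1. Qed.

Let q1_gt0 : 0 < q%:Z - 1.
Proof. by rewrite q1E ltz_nat (prim_order_gt0 prim_g). Qed.

Lemma prim_root_unit : g \is a GRing.unit.
Proof.
rewrite unitfE; apply/eqP => g0; move: (prim_expr_order prim_g).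
by rewrite g0 expr0n gtn_eqF ?(prim_order_gt0 prim_g) // => /eqP;
  rewrite eq_sym oner_eq0.
Qed.

Lemma prim_root_exprz_mod (x : int) : g ^ (x %% (q%:Z - 1))%Z = g ^ x.
Proof.
rewrite q1E [in RHS](divz_eq x q.-1) [(_ %/ _)%Z * _]mulrC.
rewrite [RHS]exprzDr ?prim_root_unit // -exprz_exp.
by rewrite -exprnP (prim_expr_order prim_g) exp1rz mul1r.
Qed.

Lemma discrete_log_mem (y : F) : y != 0 -> y \in logs.
Proof.
move=> y0; have [|k ->] := @prim_rootP _ _ _ prim_g y.
  by apply: (mulfI y0); rewrite -exprS prednK ?expf_card ?mulr1 // ltnW ?finNzRing_gt1.
by apply: map_f; rewrite mem_iota /=.
Qed.

Lemma discrete_log_exprz (x : int) : discrete_log (g ^ x) = (x %% (q%:Z - 1))%Z.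
Proof.
have m_gt0 := prim_order_gt0 prim_g.
rewrite -prim_root_exprz_mod q1E.
have : 0 <= (x %% q.-1%:Z)%Z by rewrite modz_ge0 // -lt0n.
have : (x %% q.-1%:Z)%Z < q.-1%:Z by rewrite ltz_pmod.
case: (x %% _)%Z => // k lt_k _; rewrite -exprnP /discrete_log /logs.
rewrite -{1}[k](@nth_iota 0 0 q.-1 k) ?add0n //.
rewrite -(nth_map _ 0 (fun i => g ^+ i)) ?size_iota // index_uniq ?size_map ?size_iota //.
rewrite map_inj_in_uniq ?iota_uniq // => i j; rewrite !mem_iota /= !add0n => lt_i lt_j.
by move/eqP; rewrite (eq_prim_root_expr prim_g) !modn_small // => /eqP.
Qed.

Lemma discrete_log_bound (y : F) : y != 0 -> 0 <= discrete_log y < q%:Z - 1.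
Proof.
move/discrete_log_mem; rewrite -index_mem size_map size_iota q1E => lt_y.
by rewrite /discrete_log /= ltz_nat.
Qed.

Lemma discrete_logK (y : F) : y != 0 -> g ^ discrete_log y = y.
Proof.
move/discrete_log_mem => y_logs; rewrite /discrete_log -exprnP.
have := y_logs; rewrite -index_mem {2}/logs size_map size_iota => lt_y.
by rewrite -[RHS](nth_index 0 y_logs) (nth_map 0) ?size_iota // nth_iota.
Qed.

(** The characteristic polynomial of the diagonal matrix with entries g^(v_i). *)
Definition torus_poly n (v : {ffun 'I_n -> int}) : {poly F} :=
  \prod_(x <- codom v) ('X - (g ^ x)%:P).

Lemma torus_poly_inj n (v w : {ffun 'I_n -> int}) :
    window (q%:Z - 1) (codom v) -> window (q%:Z - 1) (codom w) ->
  torus_poly v = torus_poly w -> v = w.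
Proof.
move=> win_v win_w; rewrite /torus_poly.
rewrite -!(big_map (fun x => g ^ x) predT (fun y => 'X - y%:P)).
move/prod_XsubC_eq/(perm_map discrete_log); 
rewrite -(map_comp _ _ (codom v)) -(map_comp _ _ (codom w)) => eq_mod.
have eq_codom : codom v = codom w.
  apply: (@window_mod_inj (q%:Z - 1)) => //.
  have log_exp : discrete_log \o (fun x => g ^ x) =1 modz^~ (q%:Z - 1).
    by move=> x; exact: discrete_log_exprz.
  by rewrite -!(eq_map log_exp).
apply/ffunP => i; move/eq_in_map: eq_codom; apply; exact: mem_enum.
Qed.

Lemma torus_poly_surj n (ys : seq F) : size ys = n -> \prod_(y <- ys) y = 1 ->
  exists2 v : {ffun 'I_n -> int}, window (q%:Z - 1) (codom v)
    & torus_poly v = \prod_(y <- ys) ('X - y%:P).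
Proof.
move=> sz_ys prod1.
have ys0 y : y \in ys -> y != 0.
  move=> y_ys; apply: contra_eq_neq prod1 => y0.
  by rewrite (big_rem y) //= y0 mul0r eq_sym oner_eq0.
have [|x|| s win_s mod_s] := @window_mod_surj (q%:Z - 1) _ (map discrete_log ys).
- exact: q1_gt0.
- by move=> /mapP[y /ys0/discrete_log_bound + ->].
- rewrite q1E; apply/dvdz_mod0P; rewrite -q1E -discrete_log_exprz.
  have -> : g ^ (\sum_(x <- [seq discrete_log y | y <- ys]) x) = 1.
    rewrite -prod1 big_map; elim: ys ys0 {sz_ys prod1} => [|y ys IHys] ys0.
      by rewrite !big_nil expr0z.
    rewrite !big_cons exprzDr ?prim_root_unit // discrete_logK ?ys0 ?mem_head //.
    by rewrite IHys // => z z_ys; rewrite ys0 // inE z_ys orbT.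
  by rewrite -(expr0z g) discrete_log_exprz mod0z.
have sz_s : size s = n by have := perm_size mod_s; rewrite !size_map => ->.
pose v : {ffun 'I_n -> int} := [ffun i : 'I_n => s`_i].
have codom_v : codom v = s.
  apply: (@eq_from_nth _ 0) => [|i]; rewrite size_codom card_ord ?sz_s // => lt_i.
  by rewrite (nth_map (Ordinal lt_i)) ?size_enum_ord // ffunE nth_enum_ord.
exists v; rewrite ?codom_v // /torus_poly codom_v.
rewrite (eq_bigr (fun x => 'X - (g ^ (x %% (q%:Z - 1))%Z)%:P)); last first.
  by move=> x _; rewrite prim_root_exprz_mod.
rewrite -(big_map (fun x => (x %% (q%:Z - 1))%Z) predT (fun x => 'X - (g ^ x)%:P)).
rewrite (perm_big _ mod_s) big_map; apply: eq_big_seq => y /ys0 y0.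
by rewrite discrete_logK.
Qed.

Lemma prod_XsubC_coef0 (ys : seq F) :
  (\prod_(y <- ys) ('X - y%:P))`_0 = (-1) ^+ size ys * \prod_(y <- ys) y.
Proof.
rewrite -horner_coef0 horner_prod; elim: ys => [|y ys IHys];
  first by rewrite !big_nil mulr1.
rewrite !big_cons IHys exprS hornerXsubC sub0r.
by rewrite [LHS]mulrCA -!mulrA mulN1r mulNr mulrN.
Qed.

End DiscreteLogarithm.

(** * Counting *)

Section IdentityClass.

Lemma cycle_type_eq_ones n (w : 'S_n) : perm_eq (cycle_type w) (nseq n 1%N) <-> w = 1%g.
Proof.
split=> [ones|->].
  apply/permP => x; rewrite perm1.
  have : #|porbit w x| \in cycle_type w.
    by apply/mapP; exists (porbit w x); rewrite // mem_enum; apply: imset_f.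
  rewrite (perm_mem ones) => /nseqP[/eqP/cards1P[y orb_y] _].
  have := mem_porbit w 1 x; rewrite orb_y expg1 => /set1P->.
  by have := porbit_id w x; rewrite orb_y => /set1P.
have orb1 (x : 'I_n) : porbit 1%g x = [set x].
  apply/setP => y; rewrite inE; apply/porbitP/eqP => [[i ->]|->];
    last by exists 0%N; rewrite perm1.
  by rewrite expg1n perm1.
have -> : cycle_type (1 : 'S_n)%g = nseq (size (cycle_type (1 : 'S_n)%g)) 1%N.
  apply/all_pred1P/allP => _ /mapP[C + ->]; rewrite mem_enum => /imsetP[x _ ->] /=.
  by rewrite orb1 cards1.
rewrite size_map -cardE card_imset ?card_ord // => x y; rewrite !orb1.
exact: set1_inj.
Qed.

Lemma monic_degree1 (F : fieldType) (f : {poly F}) :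
  f \is monic -> size f = 2 -> f = 'X - (- f`_0)%:P.
Proof.
move=> mon_f sz_f; rewrite polyCN opprK; apply/polyP => i; rewrite coefD coefX coefC.
case: i => [|[|i]] /=; rewrite ?add0r ?addr0 //; last by rewrite nth_default ?sz_f.
by have := monicP mon_f; rewrite /lead_coef sz_f.
Qed.

Variables (F : finFieldType) (n : nat).

(** A polynomial splits when its irreducible factors have degree 1. By uniqueness
    of factorization no other factorization of it has a different list of
    degrees, so the identity is the only permutation attached to the class. *)
Lemma Phi_identity (c : {set {'GL_n.+1[F]}}) : c \in ss_classes F n.+1 ->
  Phi c == class 1%g [set: 'S_n.+1] <->
  exists ys, class_char_poly c = \prod_(y <- ys) ('X - y%:P).
Proof.
move=> ss_c; rewrite (class1G [set: 'S_n.+1]%G).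
have [u [_ _ def_c]] := mem_ss_class ss_c.
have u_c : u \in c by rewrite def_c mem_SL_class.
have chi_u := class_char_polyE ss_c u_c.
split=> [/eqP Phi1 | [ys chi_ys]].
  have : 1%g \in Phi c by rewrite Phi1 set11.
  rewrite inE => /asboolP[v v_c [fs [irr_fs chi_fs deg_fs]]].
  exists [seq - f`_0 | f : {poly F} <- fs].
  rewrite (class_char_polyE ss_c v_c) chi_fs big_map; apply: eq_big_seq => f f_fs.
  have [mon_f [f_gt1 _]] := irr_fs f f_fs.
  apply: monic_degree1 => //.
  have : (size f).-1 \in [seq (size (h : {poly F})).-1 | h <- fs] by apply: map_f.
  rewrite (perm_mem deg_fs) (perm_mem (proj2 (cycle_type_eq_ones 1%g) erefl)).
  by case/nseqP => deg1 _; rewrite -(ltn_predK f_gt1) deg1.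
have sz_ys : size ys = n.+1.
  have [_ + _] := class_char_poly_spec ss_c.
  by rewrite chi_ys size_prod_XsubC => /succn_inj.
pose fs := [seq 'X - y%:P | y <- ys].
have deg_fs : [seq (size (f : {poly F})).-1 | f <- fs] = nseq n.+1 1%N.
  rewrite -map_comp -sz_ys; elim: (ys) => //= y s ->.
  by rewrite size_XsubC.
have irr_fs f : f \in fs -> monic_irreducible f.
  by move=> /mapP[y _ ->]; split; [apply: monicXsubC | apply: irredp_XsubC].
have chi_fs : class_char_poly c = \prod_(f <- fs) f by rewrite big_map.
apply/eqP/setP => w; rewrite !inE.
apply/asboolP/eqP => [[v v_c [gs [irr_gs chi_gs deg_gs]]]|->].
  apply/cycle_type_eq_ones; rewrite -(permPl deg_gs) -deg_fs perm_sym; apply: perm_map.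
  apply: factorization_unique irr_fs irr_gs _.
  by rewrite -chi_fs -chi_gs (class_char_polyE ss_c v_c).
exists u => //; exists fs; rewrite -chi_u deg_fs; split=> //.
by rewrite perm_sym; apply/cycle_type_eq_ones.
Qed.

End IdentityClass.

Section Counting.
Variables (F : finFieldType) (n : nat).
Local Notation q := #|F|.

(** The coefficients left free in a characteristic polynomial of the special
    linear group, whose leading and constant coefficients are known. *)
Definition middle_coefs (p : {poly F}) : {ffun 'I_n -> F} := [ffun i : 'I_n => p`_i.+1].

Definition SL_poly (p : {poly F}) : Prop :=
  [/\ p \is monic, size p = n.+2 & p`_0 = (-1) ^+ n.+1].

Lemma middle_coefs_inj p r : SL_poly p -> SL_poly r ->
  middle_coefs p = middle_coefs r -> p = r.
Proof.
move=> [mon_p sz_p p0] [mon_r sz_r r0] eq_mid; apply/polyP => -[|i]; first by rewrite p0 r0.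
have [lt_i|] := ltnP i n.
  by have /ffunP/(_ (Ordinal lt_i)) := eq_mid; rewrite !ffunE.
rewrite leq_eqVlt => /orP[/eqP <-|lt_n]; last by rewrite !nth_default ?sz_p ?sz_r.
by move: (monicP mon_p) (monicP mon_r); rewrite /lead_coef sz_p sz_r /= => -> ->.
Qed.

Lemma middle_coefs_surj a : exists2 p, SL_poly p & middle_coefs p = a.
Proof.
pose b k := if k is j.+1 then (if insub j is Some i then a i else 1) else (-1) ^+ n.+1.
have bn : b n.+1 = 1 by rewrite /b insubN // ltnn.
pose p := \poly_(i < n.+2) b i.
have sz_p : size p = n.+2 by rewrite size_poly_eq // bn oner_eq0.
exists p.
  split=> //; first by rewrite monicE /lead_coef sz_p coef_poly ltnSn bn.
  by rewrite coef_poly.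
by apply/ffunP => i; rewrite ffunE coef_poly ltnS ltnS ltnW //= valK.
Qed.

Lemma card_ss_classes : #|ss_classes F n.+1| = (q ^ n)%N.
Proof.
pose h (c : {set {'GL_n.+1[F]}}) := middle_coefs (class_char_poly c).
have h_inj : {in ss_classes F n.+1 &, injective h}.
  move=> c d ss_c ss_d eq_h; apply: class_char_poly_inj => //.
  exact: middle_coefs_inj (class_char_poly_spec ss_c) (class_char_poly_spec ss_d) eq_h.
rewrite -(card_in_imset h_inj) -[n in RHS]card_ord -card_ffun -cardsT.
apply: eq_card => a; rewrite inE; have [p [mon_p sz_p p0] <-] := middle_coefs_surj a.
have [c ss_c <-] := class_char_poly_surj mon_p sz_p p0.
exact: imset_f.
Qed.

Lemma card_identity_classes : (0 < n)%N ->
  #|[set c in ss_classes F n.+1 | Phi c == class 1%g [set: 'S_n.+1]]|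
  = #|` fset_set (cellini_vectors q (1%g : 'S_n.+1))|.
Proof.
move=> n_gt0; set C := [set c in _ | _]; set V := fset_set _.
have [g prim_g] := finField_prim_root F.
have V_window (v : {ffun 'I_n.+1 -> int}) : v \in V <-> window (q%:Z - 1) (codom v).
  rewrite /V in_fset_set; last exact: cellini_vectors_finite.
  rewrite in_setE; exact: cellini_vectors_window.
pose h (c : {set {'GL_n.+1[F]}}) := middle_coefs (class_char_poly c).
have spec_c c : c \in C -> SL_poly (class_char_poly c).
  by rewrite inE => /andP[/class_char_poly_spec].
have spec_v (v : {ffun 'I_n.+1 -> int}) : v \in V -> SL_poly (torus_poly g v).
  move=> /V_window[_ sum0 _]; rewrite /torus_poly.
  rewrite -(big_map (fun x => g ^ x) predT (fun y => 'X - y%:P)); split.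
  - exact: monic_prod_XsubC.
  - by rewrite size_prod_XsubC size_map size_codom card_ord.
  rewrite prod_XsubC_coef0 size_map size_codom card_ord big_map.
  have -> : \prod_(x <- codom v) g ^ x = g ^ (\sum_(x <- codom v) x).
    elim: (codom v) => [|x s IHs]; first by rewrite !big_nil expr0z.
    by rewrite !big_cons IHs exprzDr // (prim_root_unit prim_g).
  by rewrite sum0 expr0z mulr1.
have h_inj : {in C &, injective h}.
  move=> c d c_C d_C /(middle_coefs_inj (spec_c c c_C) (spec_c d d_C)).
  by apply: class_char_poly_inj; [move: c_C | move: d_C]; rewrite inE => /andP[].
rewrite -(card_in_imset h_inj) -[RHS](size_map (fun v => middle_coefs (torus_poly g v))).
rewrite -(card_uniqP _); last first.
  rewrite map_inj_in_uniq ?fset_uniq // => v w v_V w_V.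
  move/(middle_coefs_inj (spec_v v v_V) (spec_v w w_V)).
  by apply: (torus_poly_inj prim_g); apply/V_window.
apply: eq_card => a; apply/imsetP/mapP => [[c c_C ->]|[v v_V ->]].
  have [mon_c sz_c c0] := spec_c c c_C.
  move: c_C; rewrite inE => /andP[ss_c] /(Phi_identity ss_c)[ys def_c].
  have sz_ys : size ys = n.+1.
    by move: sz_c; rewrite def_c size_prod_XsubC => /succn_inj.
  have [|v win_v def_v] := torus_poly_surj prim_g sz_ys.
    move: c0; rewrite def_c prod_XsubC_coef0 sz_ys -[RHS]mulr1 => /mulfI-> //.
    by rewrite signr_eq0.
  by exists v; rewrite /h ?def_c ?def_v //; apply/V_window.
have [mon_v sz_v v0] := spec_v v v_V.
have [c ss_c def_c] := class_char_poly_surj mon_v sz_v v0.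
exists c; last by rewrite /h def_c.
rewrite inE ss_c; apply/(Phi_identity ss_c); exists [seq g ^ x | x <- codom v].
by rewrite def_c /torus_poly [RHS]big_map.
Qed.

End Counting.

Theorem corollary2 (n q : nat) (F : finFieldType)
    (hn : (1 < n)%N) (hq : #|F| = q) :
  #|[set c in ss_classes F n | Phi c == class 1%g [set: 'S_n]]|%:R
    / #|ss_classes F n|%:R
  = cellini n q 1%g :> rat.
Proof.
case: n hn => // n n_gt0; rewrite -hq card_identity_classes // card_ss_classes.
by rewrite ffunE natrX.
Qed.
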